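(* Let $\{A,B,C\}$ be a set of three distinct points, all in $H^2$ or all in $-H^2$ (a hyperbolic or antipodal hyperbolic triangle), with side lengths $a,b,c$ opposite $A,B,C$ and angles $\alpha,\beta,\gamma$ at $A,B,C$, respectively. Then $$\cosh(a)=\cosh(b)\cosh(c)-\cos(\alpha)\sinh(b)\sinh(c),$$ $$\cosh(b)=\cosh(a)\cosh(c)-\cos(\beta)\sinh(a)\sinh(c),$$ $$\cosh(c)=\cosh(a)\cosh(b)-\cos(\gamma)\sinh(a)\sinh(b).$$
   Context: On $\mathbb{R}^3$ let $\langle\langle x,y\rangle\rangle=-x_1y_1+x_2y_2+x_3y_3$, $|||x|||=\sqrt{|\langle\langle x,x\rangle\rangle|}$, and let $\times$ be the usual Euclidean cross product. $H^2=\{x:\langle\langle x,x\rangle\rangle=-1,\ x_1>0\}$ and $-H^2=\{-x:x\in H^2\}$. For $x,y$ both in $H^2$ or both in $-H^2$ the distance is $d(x,y)=\operatorname{arcosh}(-\langle\langle x,y\rangle\rangle)$. Side lengths: $a=d(B,C)$, $b=d(A,C)$, $c=d(A,B)$. For distinct $A,B$ both in $H^2$ or both in $-H^2$, the unit tangent vector at $A$ towards $B$ is $X_{AB}=\dfrac{B+\langle\langle A,B\rangle\rangle A}{|||A\times B|||}$. The angle at $A$ is $\alpha=\arccos(\langle\langle X_{AB},X_{AC}\rangle\rangle)$; $\beta$ (at $B$) and $\gamma$ (at $C$) are defined analogously. *)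

(* Defs.v *)
From Stdlib Require Import Reals Lra.
From Coquelicot Require Import Coquelicot.
Open Scope R_scope.

(* Vector operations on R3 ([plus], [opp], [scal]) are those of Coquelicot's
   product module structure. *)
Definition R3 : Type := (R * R * R)%type.

Definition mink (x y : R3) : R :=
  let '(x1, x2, x3) := x in
  let '(y1, y2, y3) := y in
  - (x1 * y1) + x2 * y2 + x3 * y3.

Definition mnorm (x : R3) : R := sqrt (Rabs (mink x x)).

(* The Euclidean cross product, not its Lorentzian variant. *)
Definition cross (x y : R3) : R3 :=
  let '(x1, x2, x3) := x in
  let '(y1, y2, y3) := y in
  (x2 * y3 - x3 * y2, x3 * y1 - x1 * y3, x1 * y2 - x2 * y1).

Definition H2 (x : R3) : Prop := mink x x = -1 /\ 0 < fst (fst x).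

Definition negH2 (x : R3) : Prop := exists y : R3, H2 y /\ x = opp y.

(* Stdlib has [arcsinh] but no inverse of [cosh]; the lemmas below check that,
   on [1, +oo), this is the nonnegative one. *)
Definition arcosh (x : R) : R := ln (x + sqrt (x ^ 2 - 1)).

Lemma cosh_arcosh (x : R) : 1 <= x -> cosh (arcosh x) = x.
Proof.
intros Hx; unfold cosh, arcosh.
assert (Hs := sqrt_pos (x ^ 2 - 1)).
assert (Hq : sqrt (x ^ 2 - 1) * sqrt (x ^ 2 - 1) = x ^ 2 - 1)
  by (apply sqrt_sqrt; nra).
set (s := sqrt (x ^ 2 - 1)) in *.
rewrite exp_Ropp, exp_ln by lra.
replace (/ (x + s)) with (x - s); [lra|].
apply Rmult_eq_reg_r with (x + s); [|lra].
rewrite Rinv_l by lra; nra.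
Qed.

Lemma arcosh_ge0 (x : R) : 1 <= x -> 0 <= arcosh x.
Proof.
intros Hx; unfold arcosh; rewrite <- ln_1.
assert (Hs := sqrt_pos (x ^ 2 - 1)).
apply ln_le; lra.
Qed.

(* [hdist], [tangent] and [angle] are total; they have their geometric meaning
   for (distinct) points lying all in [H2] or all in [negH2]. *)
Definition hdist (x y : R3) : R := arcosh (- mink x y).

Definition tangent (A B : R3) : R3 :=
  scal (/ mnorm (cross A B)) (plus B (scal (mink A B) A)).

(* The angle at the first point [A], between the directions to [B] and [C]. *)
Definition angle (A B C : R3) : R := acos (mink (tangent A B) (tangent A C)).

Definition hyp_triangle (A B C : R3) : Prop :=
  A <> B /\ A <> C /\ B <> C /\
  ((H2 A /\ H2 B /\ H2 C) \/ (negH2 A /\ negH2 B /\ negH2 C)).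

(* Main.v *)
(** The Minkowski Gram determinant of the three points is [- det^2 <= 0], which is
    exactly the statement that [<<X_AB, X_AC>> = (cosh b cosh c - cosh a) / (sinh b sinh c)]
    lies in [[-1, 1]]; hence [cos] inverts the [acos] defining the angle and the
    law of cosines is a rearrangement of this formula. *)
Require Import Defs.
From Stdlib Require Import Reals Lra.
From Coquelicot Require Import Coquelicot.
Open Scope R_scope.

Lemma mink_comm (x y : R3) : mink x y = mink y x.
Proof. destruct x as [[x1 x2] x3], y as [[y1 y2] y3]; simpl; ring. Qed.

Lemma hdist_comm (x y : R3) : hdist x y = hdist y x.
Proof. unfold hdist; now rewrite mink_comm. Qed.

(** As [mink A A = -1], adding [mink A B] times [A] projects [B] onto the Minkowski-orthogonal
    complement of [A]. Of the two cross terms, one cancels against the [mink A A] term. *)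
Lemma mink_tangent_arg (A B C : R3) : mink A A = -1 ->
  mink (plus B (scal (mink A B) A)) (plus C (scal (mink A C) A)) =
  mink B C + mink A B * mink A C.
Proof.
intros HA.
transitivity (mink B C + 2 * (mink A B * mink A C)
              + mink A B * mink A C * mink A A).
- destruct A as [[a1 a2] a3], B as [[b1 b2] b3], C as [[c1 c2] c3].
  unfold plus, scal; simpl; unfold plus, scal, mult; simpl; unfold mult; simpl.
  ring.
- rewrite HA; ring.
Qed.

Lemma mink_scal (k l : R) (x y : R3) :
  mink (scal k x) (scal l y) = k * l * mink x y.
Proof.
destruct x as [[x1 x2] x3], y as [[y1 y2] y3].
unfold scal; simpl; unfold scal, mult; simpl; unfold mult; simpl; ring.
Qed.

(** Lorentzian form of Lagrange's identity. The Euclidean cross product serves as well as the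
    Lorentzian one, since coordinate signs do not affect [mink] of a vector with itself. *)
Lemma mink_cross (x y : R3) :
  mink (cross x y) (cross x y) = mink x y ^ 2 - mink x x * mink y y.
Proof. destruct x as [[x1 x2] x3], y as [[y1 y2] y3]; simpl; ring. Qed.

Definition det3 (x y z : R3) : R :=
  let '(x1, x2, x3) := x in
  let '(y1, y2, y3) := y in
  let '(z1, z2, z3) := z in
  x1 * (y2 * z3 - y3 * z2) - x2 * (y1 * z3 - y3 * z1) + x3 * (y1 * z2 - y2 * z1).

(** The left side expands the determinant of the Gram matrix along its first row. That matrix is M^T
    J M with J = diag(-1, 1, 1), and det J = -1 gives the sign. *)
Lemma mink_gram (x y z : R3) :
  mink x x * (mink y y * mink z z - mink y z ^ 2)
  - mink x y * (mink x y * mink z z - mink y z * mink x z)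
  + mink x z * (mink x y * mink y z - mink y y * mink x z)
  = - det3 x y z ^ 2.
Proof.
destruct x as [[x1 x2] x3], y as [[y1 y2] y3], z as [[z1 z2] z3]; simpl; ring.
Qed.

(** The positive product of first coordinates covers both sheets at once, being invariant under
    negating both points. *)
Definition same_sheet (x y : R3) : Prop :=
  mink x x = -1 /\ mink y y = -1 /\ 0 < fst (fst x) * fst (fst y).

Lemma same_sheet_sym (x y : R3) : same_sheet x y -> same_sheet y x.
Proof. unfold same_sheet; rewrite Rmult_comm; tauto. Qed.

Lemma same_sheet_H2 (x y : R3) :
  (H2 x /\ H2 y) \/ (negH2 x /\ negH2 y) -> same_sheet x y.
Proof.
intros [[[Hx Px] [Hy Py]] | [[u [[Hu Pu] ->]] [v [[Hv Pv] ->]]]].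
- repeat split; trivial; nra.
- destruct u as [[u1 u2] u3], v as [[v1 v2] v3]; unfold same_sheet.
  unfold opp; simpl in *; unfold opp; simpl.
  repeat split; nra.
Qed.

(* With [x = (x1, u)], [y = (y1, v)], Lagrange's identity gives
   [(x1 y1)^2 = (1 + u.v)^2 + |u - v|^2 + (u x v)^2]. *)
Lemma same_sheet_mink (x y : R3) : same_sheet x y -> x <> y -> 1 < - mink x y.
Proof.
destruct x as [[x1 x2] x3], y as [[y1 y2] y3]; unfold same_sheet; simpl.
intros [Hx [Hy P]] D.
apply Rnot_le_lt; intros L; apply D.
assert (E : (x1 * y1) ^ 2 = (1 + (x2 * y2 + x3 * y3)) ^ 2 + (x2 - y2) ^ 2
            + (x3 - y3) ^ 2 + (x2 * y3 - x3 * y2) ^ 2).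
{ replace ((x1 * y1) ^ 2) with ((x1 * x1) * (y1 * y1)) by ring.
  replace (x1 * x1) with (1 + x2 * x2 + x3 * x3) by lra.
  replace (y1 * y1) with (1 + y2 * y2 + y3 * y3) by lra.
  ring. }
(* [P] allows squaring [L]; compared with [E], this forces all three remaining squares to vanish. *)
assert (L2 : (x1 * y1) ^ 2 <= (1 + (x2 * y2 + x3 * y3)) ^ 2)
  by (apply pow_incr; lra).
assert (S1 := pow2_ge_0 (x2 - y2)).
assert (S2 := pow2_ge_0 (x3 - y3)).
assert (S3 := pow2_ge_0 (x2 * y3 - x3 * y2)).
assert (Z2 : x2 = y2) by (apply Rminus_diag_uniq, Rsqr_eq_0; unfold Rsqr; lra).
assert (Z3 : x3 = y3) by (apply Rminus_diag_uniq, Rsqr_eq_0; unfold Rsqr; lra).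
subst y2 y3.
assert (F : (x1 - y1) * (x1 + y1) = 0) by lra.
apply Rmult_integral in F; destruct F as [F | F].
- now replace y1 with x1 by lra.
- replace y1 with (- x1) in P by lra; nra.
Qed.

Lemma sinh_arcosh (x : R) : 1 <= x -> sinh (arcosh x) = sqrt (x ^ 2 - 1).
Proof.
intros Hx.
assert (Hc := cosh_arcosh x Hx).
assert (Hs : exp (arcosh x) = x + sqrt (x ^ 2 - 1)).
{ unfold arcosh; apply exp_ln.
  assert (H := sqrt_pos (x ^ 2 - 1)); lra. }
unfold cosh in Hc; unfold sinh; lra.
Qed.

(** Identifies the normalising factor of [tangent]: by [mink_cross] both sides are the square root
    of [mink x y ^ 2 - 1]. *)
Lemma mnorm_cross (x y : R3) : same_sheet x y -> x <> y ->
  mnorm (cross x y) = sinh (hdist x y).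
Proof.
intros S D; assert (H := same_sheet_mink x y S D).
destruct S as [Hx [Hy _]].
unfold mnorm, hdist; rewrite mink_cross, Hx, Hy, sinh_arcosh by lra.
rewrite Rabs_pos_eq by nra; f_equal; ring.
Qed.

Lemma sinh_hdist_pos (x y : R3) : same_sheet x y -> x <> y ->
  0 < sinh (hdist x y).
Proof.
intros S D; assert (H := same_sheet_mink x y S D).
unfold hdist; rewrite sinh_arcosh by lra; apply sqrt_lt_R0; nra.
Qed.

Lemma cosh_hdist (x y : R3) : same_sheet x y -> x <> y ->
  cosh (hdist x y) = - mink x y.
Proof.
intros S D; apply cosh_arcosh; apply Rlt_le; now apply same_sheet_mink.
Qed.

Lemma cosh2_sinh2 (x : R) : sinh x ^ 2 = cosh x ^ 2 - 1.
Proof.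
unfold sinh, cosh; rewrite exp_Ropp; field; apply Rgt_not_eq, exp_pos.
Qed.

Lemma hyperbolic_law_of_cosines (A B C : R3) :
  same_sheet A B -> same_sheet A C -> same_sheet B C ->
  A <> B -> A <> C -> B <> C ->
  cosh (hdist B C) =
  cosh (hdist A C) * cosh (hdist A B)
  - cos (angle A B C) * sinh (hdist A C) * sinh (hdist A B).
Proof.
intros SAB SAC SBC DAB DAC DBC.
assert (Pc := sinh_hdist_pos A B SAB DAB).
assert (Pb := sinh_hdist_pos A C SAC DAC).
assert (Qc := cosh2_sinh2 (hdist A B)).
assert (Qb := cosh2_sinh2 (hdist A C)).
assert (G := mink_gram A B C).
assert (Hd := pow2_ge_0 (det3 A B C)).
unfold angle, tangent.
rewrite mink_scal, mink_tangent_arg by apply SAB.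
rewrite (mnorm_cross A B), (mnorm_cross A C) by assumption.
rewrite (cosh_hdist A B) in * by assumption.
rewrite (cosh_hdist A C) in * by assumption.
rewrite (cosh_hdist B C) by assumption.
destruct SAB as [HA [HB _]]; destruct SAC as [_ [HC _]].
rewrite HA, HB, HC in G.
set (p := mink A B) in *; set (q := mink A C) in *; set (r := mink B C) in *.
set (s := sinh (hdist A B)) in *; set (t := sinh (hdist A C)) in *.
(* [w] is the argument of [acos]. Here [p], [q], [r] are minus the hyperbolic cosines of the sides
   [AB], [AC], [BC]. *)
set (w := / s * / t * (r + p * q)).
assert (Hw : w * (s * t) = r + p * q) by (unfold w; field; split; lra).
assert (Pst : 0 < s * t) by (apply Rmult_lt_0_compat; assumption).
(* By [G], the right side minus the left is exactly [det3 A B C ^ 2]. *)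
assert (Hle : (r + p * q) ^ 2 <= (s * t) ^ 2).
{ replace ((s * t) ^ 2) with (s ^ 2 * t ^ 2) by ring.
  rewrite Qc, Qb; lra. }
assert (Hw2 : w ^ 2 <= 1).
{ apply Rmult_le_reg_r with ((s * t) ^ 2); [now apply pow_lt|].
  rewrite <- Rpow_mult_distr, Hw; lra. }
assert (Hw1 : -1 <= w <= 1) by (split; nra).
rewrite cos_acos by assumption.
lra.
Qed.

Theorem theorem5p1 (A B C : R3) (a b c alpha beta gamma : R)
  (HABC : hyp_triangle A B C)
  (Ha : a = hdist B C) (Hb : b = hdist A C) (Hc : c = hdist A B)
  (Halpha : alpha = angle A B C)
  (Hbeta : beta = angle B A C)
  (Hgamma : gamma = angle C A B) :
  cosh a = cosh b * cosh c - cos alpha * sinh b * sinh c /\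
  cosh b = cosh a * cosh c - cos beta * sinh a * sinh c /\
  cosh c = cosh a * cosh b - cos gamma * sinh a * sinh b.
Proof.
destruct HABC as [DAB [DAC [DBC H]]].
assert (SAB : same_sheet A B) by (apply same_sheet_H2; tauto).
assert (SAC : same_sheet A C) by (apply same_sheet_H2; tauto).
assert (SBC : same_sheet B C) by (apply same_sheet_H2; tauto).
assert (SBA := same_sheet_sym _ _ SAB).
assert (SCA := same_sheet_sym _ _ SAC).
assert (SCB := same_sheet_sym _ _ SBC).
subst; repeat split.
- now apply hyperbolic_law_of_cosines.
(* The other two vertices use the triples [B A C] and [C A B]; only distances read in the opposite
   direction need symmetry. *)
- rewrite (hdist_comm A B); apply hyperbolic_law_of_cosines; auto.
- rewrite (hdist_comm B C), (hdist_comm A C).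
  apply hyperbolic_law_of_cosines; auto.
Qed.
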